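(* Let $a>0$ and let $B_a=\{(x,y)\in\mathbb{R}^2: x^2+y^2<a^2\}$. Let $n\ge 0$ and $m\ge 1$ be integers with $\frac{\alpha_{n,m}^2}{a^2}>\lambda_1$, where $\lambda_1=\frac{\alpha_{0,1}^2}{a^2}$ is the principal eigenvalue of the Laplacian on $B_a$ with zero Dirichlet boundary condition. Let $$w(r,\theta)=J_n\left(\frac{\alpha_{n,m}}{a}r\right)\left(A\cos n\theta+B\sin n\theta\right)$$ (in polar coordinates) be any element of the eigenspace of the eigenvalue $\frac{\alpha_{n,m}^2}{a^2}$, normalized so that $A^2+B^2=1$. Then, the integrals being taken over the subsets of $B_a$ where $w>0$ and where $w<0$ respectively, $$\int_{w>0}w(r,\theta)\,r\,dr\,d\theta=J_{n,m},\qquad \int_{w<0}w(r,\theta)\,r\,dr\,d\theta=-J_{n,m}.$$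
   Context: $J_n$ denotes the Bessel function of the first kind of order $n$, and $\alpha_{n,m}$ denotes its $m$-th positive zero. Polar coordinates are $x=r\cos\theta$, $y=r\sin\theta$. The eigenvalues of the Laplacian on $B_a$ with zero Dirichlet condition (values $\lambda$ for which $\Delta u+\lambda u=0$ in $B_a$, $u=0$ on $\partial B_a$ has nontrivial solutions) are $\alpha_{n,m}^2/a^2$ ($n=0,1,2,\dots$; $m=1,2,\dots$), with corresponding eigenfunctions $J_n\left(\frac{\alpha_{n,m}}{a}r\right)(A\cos n\theta+B\sin n\theta)$, where $A,B$ are real constants. The number $J_{n,m}$ is defined by $$J_{n,m}=2\int_{P_{n,m}}J_n\left(\tfrac{\alpha_{n,m}}{a}r\right)r\,dr-2\int_{N_{n,m}}J_n\left(\tfrac{\alpha_{n,m}}{a}r\right)r\,dr,$$ where $P_{n,m}$ is the set of $r\in(0,a)$ with $J_n\left(\frac{\alpha_{n,m}}{a}r\right)>0$ and $N_{n,m}$ is the set of $r\in(0,a)$ with $J_n\left(\frac{\alpha_{n,m}}{a}r\right)<0$.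
   Formalization: The formal theorem assumes n ≥ 1 instead of n ≥ 0; for n = 0 the claim is false for every A, B (e.g. A = 0, B = 1 gives w = 0 while J_{0,m} > 0, and for A ≠ 0 the two integrals do not sum to 0). *)

(* Defs.v *)
From HB Require Import structures.
From mathcomp Require Import all_boot all_order all_algebra.
From mathcomp Require Import all_classical all_reals all_analysis.

Set Implicit Arguments.
Unset Strict Implicit.
Unset Printing Implicit Defensive.

Import Order.TTheory GRing.Theory Num.Theory.
Import numFieldNormedType.Exports.

Local Open Scope classical_set_scope.
Local Open Scope card_scope.
Local Open Scope ring_scope.

Definition besselJ_coeff {R : realType} (n : nat) (x : R) : R^nat :=
  [sequence (-1) ^+ k / (k`! * (n + k)`!)%:R * (x / 2) ^+ (2 * k + n)]_k.

Definition besselJ {R : realType} (n : nat) (x : R) : R :=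
  limn (series (besselJ_coeff n x)).

(* [x] is the [m]-th positive zero of J_n: it is a zero, and exactly [m]
   positive zeros (counting [x]) are at most [x]. *)
Definition is_besselJ_zero {R : realType} (n m : nat) (x : R) : Prop :=
  [/\ 0 < x, besselJ n x = 0 &
      [set y : R | 0 < y <= x /\ besselJ n y = 0] #= `I_m].

(* At most one real satisfies [is_besselJ_zero n m], and for [1 <= m] one does;
   the value for [m = 0] is irrelevant. *)
Definition besselJ_zero {R : realType} (n m : nat) : R :=
  xget 0 [set x : R | is_besselJ_zero n m x].

Definition dirichlet_eigenvalue {R : realType} (a : R) (n m : nat) : R :=
  besselJ_zero n m ^+ 2 / a ^+ 2.

Definition principal_eigenvalue {R : realType} (a : R) : R :=
  dirichlet_eigenvalue a 0 1.

Definition radial_part {R : realType} (a : R) (n m : nat) (r : R) : R :=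
  besselJ n (besselJ_zero n m / a * r).

(* A point [p] stands for the polar coordinates (r, theta). *)
Definition eigenfunction {R : realType} (a : R) (n m : nat) (A B : R)
    (p : R * R) : R :=
  radial_part a n m p.1 * (A * cos (n%:R * p.2) + B * sin (n%:R * p.2)).

Definition disk {R : realType} (a : R) : set (R * R) :=
  [set q | q.1 ^+ 2 + q.2 ^+ 2 < a ^+ 2].

Definition polar {R : realType} (p : R * R) : R * R :=
  (p.1 * cos p.2, p.1 * sin p.2).

(* Each point of [D] other than the origin has exactly one preimage here. *)
Definition polar_region {R : realType} (D : set (R * R)) : set (R * R) :=
  [set p | [/\ 0 <= p.1, 0 <= p.2 < 2 * pi & D (polar p)]].

Definition besselJ_integral {R : realType} (a : R) (n m : nat) : R :=
  2 * Rintegral lebesgue_measure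
        [set r : R | 0 < r < a /\ 0 < radial_part a n m r]
        (fun r => radial_part a n m r * r)
  - 2 * Rintegral lebesgue_measure
        [set r : R | 0 < r < a /\ radial_part a n m r < 0]
        (fun r => radial_part a n m r * r).

(* The integral of [w] over [S] in plane polar coordinates, i.e. against the
   area element [r dr dtheta]. *)
Definition polar_integral {R : realType} (S : set (R * R)) (w : R * R -> R) :
    \bar R :=
  (\int[(@lebesgue_measure R \x @lebesgue_measure R)%E]_(p in S)
     (w p * p.1)%:E)%E.

(* Main.v *)
(** On the polar product domain, w = f(r) g(t) is positive exactly on
    {f > 0} x {g > 0} and {f < 0} x {g < 0}, so Tonelli reduces the integral to
    radial integrals times the angular integrals of the positive and negative
    parts of g(t) = A cos nt + B sin nt. Both angular integrals are 2: writing
    g(t) = cos (nt + phi) and letting F be a primitive of |cos|, the positive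
    part of g has primitive (F + sin)(nt + phi) / 2n, and F grows by 2 over each
    half period. The case w < 0 follows by replacing (A, B) with (-A, -B). *)

Require Import Defs.
From HB Require Import structures.
From mathcomp Require Import all_boot all_order all_algebra.
From mathcomp Require Import all_classical all_reals all_analysis measurable_realfun.
From mathcomp Require Import ring lra.

Import Order.TTheory GRing.Theory Num.Theory.
Import numFieldNormedType.Exports.

Local Open Scope classical_set_scope.
Local Open Scope ring_scope.

(** * Convergence, growth and measurability of the Bessel series *)

(** Discarding the factor (n + k)! >= 1 from the denominator leaves a multiple of the exponential
    series at (x / 2)^2. *)
Lemma normr_besselJ_coeff_le {R : realType} n (x : R) k :
  `|besselJ_coeff n x k| <= (`|x| / 2) ^+ n * exp_coeff ((x / 2) ^+ 2) k.
Proof.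
have -> : `|besselJ_coeff n x k| =
    ((x / 2) ^+ 2) ^+ k * (`|x| / 2) ^+ n / (k`! * (n + k)`!)%:R.
  rewrite /besselJ_coeff /= !normrM normrX normrN1 expr1n mul1r.
  rewrite normfV normr_nat normrX exprD exprM real_normK ?num_real//.
  by rewrite normrM [`|2^-1|]ger0_norm// mulrC.
rewrite /exp_coeff /= mulrCA mulrA.
rewrite ler_wpM2l//.
  by rewrite mulr_ge0// exprn_ge0 ?sqr_ge0 ?divr_ge0.
rewrite lef_pV2 ?posrE ?ltr0n ?muln_gt0 ?fact_gt0//.
by rewrite ler_nat leq_pmulr ?fact_gt0.
Qed.

Lemma cvg_normed_besselJ_coeff {R : realType} n (x : R) :
  cvgn [normed series (besselJ_coeff n x)].
Proof.
apply: (series_le_cvg (fun k => normr_ge0 (besselJ_coeff n x k)) _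
          (normr_besselJ_coeff_le n x)).
  by move=> k; rewrite mulr_ge0 ?exprn_ge0 ?exp_coeff_ge0 ?divr_ge0 ?sqr_ge0.
exact/is_cvg_seriesZ/is_cvg_series_exp_coeff.
Qed.

Lemma normr_besselJ_le {R : realType} n (x : R) :
  `|besselJ n x| <= (`|x| / 2) ^+ n * expR ((x / 2) ^+ 2).
Proof.
have ce := is_cvg_series_exp_coeff ((x / 2) ^+ 2).
apply: le_trans (lim_series_norm (cvg_normed_besselJ_coeff n x)) _.
rewrite /expR -[leRHS]/(_ *: _) -(lim_seriesZ _ ce).
apply: lim_series_le (normr_besselJ_coeff_le n x).
  exact: cvg_normed_besselJ_coeff.
exact: is_cvg_seriesZ.
Qed.

Lemma measurable_besselJ {R : realType} n :
  measurable_fun [set: R] (@besselJ R n).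
Proof.
apply: (measurable_fun_cvg (h := fun m x => series (besselJ_coeff n x) m)).
  move=> m; apply: measurable_sum => k; apply: measurable_funM => //.
  by apply: measurable_funX; exact: measurable_funM.
by move=> x _; exact/normed_cvg/cvg_normed_besselJ_coeff.
Qed.

(** * Tonelli for separated integrands on a product set *)

Lemma ge0_integral_setX {d1 d2 : measure_display} {T1 : measurableType d1}
    {T2 : measurableType d2} {R : realType}
    (m1 : {sigma_finite_measure set T1 -> \bar R})
    (m2 : {sigma_finite_measure set T2 -> \bar R})
    (A : set T1) (B : set T2) (u : T1 -> R) (v : T2 -> R) :
  measurable A -> measurable B ->
  measurable_fun A u -> measurable_fun B v ->
  (forall x, A x -> 0 <= u x) -> (forall y, B y -> 0 <= v y) ->
  (\int[(m1 \x m2)%E]_(p in A `*` B) (u p.1 * v p.2)%:E =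
   (\int[m1]_(x in A) (u x)%:E) * \int[m2]_(y in B) (v y)%:E)%E.
Proof.
move=> mA mB mu mv u0 v0.
have u'0 x : 0 <= (u \_ A) x by rewrite patchE; case: ifPn => // /set_mem /u0.
have v'0 x : 0 <= (v \_ B) x by rewrite patchE; case: ifPn => // /set_mem /v0.
have mu' : measurable_fun setT (u \_ A) by exact/(measurable_restrictT _ mA).1.
have mv' : measurable_fun setT (v \_ B) by exact/(measurable_restrictT _ mB).1.
have restr (dT : measure_display) (T : measurableType dT) (D : set T) (f : T -> R) :
    (fun x => (f x)%:E) \_ D = (fun x => ((f \_ D) x)%:E).
  by apply/funext => x; rewrite !patchE; case: ifP.
rewrite integral_mkcond restr.
rewrite [in RHS]integral_mkcond restr [X in (_ * X)%E]integral_mkcond restr.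
(* Extension by zero respects products, so the integrand stays separated on the whole space, where
   Tonelli applies. *)
rewrite (_ : _ \_ (A `*` B) = fun p => (u \_ A) p.1 * (v \_ B) p.2); last first.
  apply/funext => -[x y]; rewrite !patchE/= in_setX/=.
  by case: (x \in A) => /=; case: (y \in B) => /=; rewrite ?mul0r ?mulr0.
rewrite fubini_tonelli1/=; last first.
- by move=> p; rewrite lee_fin mulr_ge0.
- apply/measurable_EFinP/measurable_funM.
    exact: measurableT_comp mu' measurable_fst.
  exact: measurableT_comp mv' measurable_snd.
rewrite /fubini_F.
transitivity (\int[m1]_x
    ((\int[m2]_y ((v \_ B) y)%:E) * ((u \_ A) x)%:E))%E.
  apply: eq_integral => x _ /=.
  rewrite muleC -ge0_integralZl//; last 3 first.
  - exact/measurable_EFinP.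
  - by move=> y _; rewrite lee_fin.
  - by rewrite lee_fin.
rewrite ge0_integralZl//.
- by rewrite muleC.
- exact/measurable_EFinP.
- by move=> y _; rewrite lee_fin.
- by apply: integral_ge0 => y _; rewrite lee_fin.
Qed.

(** * Primitives on a half-line and the growth of a primitive of |cos| *)

Lemma is_derive_continuous {R : realType} (f : R -> R) (x df : R) :
  is_derive x 1 f df -> {for x, continuous f}.
Proof. by move=> [fx _]; exact/differentiable_continuous/derivable1_diffP. Qed.

(** Mean value theorem. The half-line form fits primitives defined as integrals from a base point
    [c], whose derivative is known only to the right of [c]. *)
Lemma is_derive_0_cst_gt {R : realType} (f : R -> R) (c x y : R) :
  (forall z, c < z -> is_derive z 1 f 0) -> c < x -> c < y -> f x = f y.
Proof.
move=> f'0; wlog xy : x y / x <= y.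
  by move=> H cx cy; case: (leP x y) => [|/ltW] xy; [|symmetry]; exact: H.
move=> cx cy; rewrite -(subKr (f y) (f x)).
have [||_ _] := @MVT_segment _ f (fun=> 0) _ _ xy; last by rewrite mul0r => ->; rewrite subr0.
  by move=> z; rewrite in_itv/= => /andP[xz _]; exact/f'0/(lt_trans cx).
apply: derivable_within_continuous => z; rewrite in_itv/= => /andP[xz _].
by have [] := f'0 z (lt_le_trans cx xz).
Qed.

Lemma continuous_primitive_gt {R : realType} (f : R -> R) (c : R) :
  continuous f -> exists F : R -> R, forall x, c < x -> is_derive x 1 F (f x).
Proof.
move=> cf; exists (fun x => \int[lebesgue_measure]_(t in `[c, x]) f t)%R => x cx.
(* The endpoint [x + 1] only serves to make [x] an interior point. *)
have [||dF F'] := @continuous_FTC1_closed R f c x (x + 1) _ _ cx (cf x).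
- by rewrite ltrDl.
- apply: continuous_compact_integrable; first exact: segment_compact.
  exact: continuous_subspaceT.
- by split; [exact: dF|rewrite -derive1E; exact: F'].
Qed.

(* [x |-> F (x + pi) - F x] has derivative zero; its value is read off at
   [- pi / 2], where [F - sin] is constant up to [pi / 2]. *)
Lemma abs_cos_primitive_shift {R : realType} (F : R -> R) (c : R) :
  c < - (pi / 2) -> (forall x, c < x -> is_derive x 1 F `|cos x|) ->
  forall x, c < x -> F (x + pi) = F x + 2.
Proof.
move=> cpi dF x cx; pose D y := F (y + pi) - F y.
suff : D x = 2 by rewrite /D; lra.
have pi0 := @pi_gt0 R.
have dD y : c < y -> is_derive y 1 D 0.
  move=> cy; have cypi : c < y + pi by rewrite (lt_le_trans cy)// lerDl ltW.
  have := dF _ cypi; have := dF _ cy; rewrite cosDpi normrN => d1 d2.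
  have d3 : is_derive y 1 (fun y => F (y + pi)) (`|cos y| * (1 + 0)).
    exact: (@is_derive1_comp _ F (fun y => y + pi)).
  by apply: is_derive_eq; rewrite addr0 mulr1 subrr.
rewrite (is_derive_0_cst_gt _ _ _ _ dD cx cpi) /D.
rewrite addrC (_ : - _ + pi = pi / 2); last by field.
have [|||z _] := @MVT_segment _ (F \- sin) (fun=> 0) (- (pi / 2)) (pi / 2).
- lra.
- move=> z; rewrite in_itv/= => /andP[z1 z2].
  have dFz := dF _ (lt_trans cpi z1).
  apply: is_derive_eq; rewrite ger0_norm ?subrr//.
  by rewrite cos_ge0_pihalf// !ltW.
- apply: derivable_within_continuous => z; rewrite in_itv/= => /andP[z1 _].
  have [dFz _] := dF _ (lt_le_trans cpi z1).
  by apply: derivableB dFz _; exact: derivable_sin.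
by rewrite mul0r /= sinN sin_pihalf; lra.
Qed.

(** * The angular integral *)

(** The angle is [acos A] up to sign. Its lower bound allows one base point, chosen independently of
    the angle, for the primitive of |cos|. *)
Lemma sqrD1_cos_sin {R : realType} (A B : R) : A ^+ 2 + B ^+ 2 = 1 ->
  exists2 phi, - pi <= phi & cos phi = A /\ sin phi = B.
Proof.
move=> AB; have A1 : -1 <= A <= 1 by apply/andP; split; have := sqr_ge0 B; nra.
have [/andP[p0 _] cA] := acos_def A1; have pi0 := @pi_gt0 R.
have [s|s] : sin (acos A) = B \/ sin (acos A) = - B.
  have : sin (acos A) ^+ 2 == B ^+ 2 by rewrite sin2cos2 cA; apply/eqP; lra.
  by rewrite eqf_sqr => /orP[]/eqP; [left|right].
- by exists (acos A) => //; lra.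
- exists (- acos A); first by have := acos_lepi A1; lra.
  by rewrite cosN sinN s opprK.
Qed.

(** The case n = 0 is genuinely different: the integrand is then the constant max(A, 0), with
    integral 2 pi max(A, 0). *)
Lemma integral_pos_part_sinusoid {R : realType} (n : nat) (A B : R) :
  (1 <= n)%N -> A ^+ 2 + B ^+ 2 = 1 ->
  (\int[lebesgue_measure]_(t in `[0%R, (2 * pi)%R])
    (Num.max (A * cos (n%:R * t) + B * sin (n%:R * t)) 0)%:E = 2%:E)%E.
Proof.
move=> n0 AB.
(* The sign of [- B] matches cos (nt + phi) = cos nt cos phi - sin nt sin phi. *)
have [phi phipi [cphi sphi]] : exists2 phi, - pi <= phi & cos phi = A /\ sin phi = - B.
  by apply: sqrD1_cos_sin; rewrite sqrrN.
have pi0 := @pi_gt0 R.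
have n0' : 0 < n%:R :> R by rewrite ltr0n.
(* The base point [- pi - 1] lies strictly below every phase nt + phi with t >= 0, and below - pi /
   2 as the shift lemma requires. *)
have [F dF] : exists F, forall x : R, - pi - 1 < x -> is_derive x 1 F `|cos x|.
  apply: (@continuous_primitive_gt R (fun x => `|cos x|)) => x.
  by apply: continuous_comp; [exact: continuous_cos|exact: norm_continuous].
have shift1 : forall x, - pi - 1 < x -> F (x + pi) = F x + 2.
  by apply: abs_cos_primitive_shift dF; lra.
have shift k x : - pi - 1 < x -> F (x + k%:R * pi) = F x + k%:R * 2.
  move=> cx; elim: k => [|k IH]; first by rewrite !mul0r !addr0.
  rewrite -natr1 !mulrDl !mul1r addrA shift1 ?IH ?addrA//.
  by rewrite (lt_le_trans cx)// lerDl mulr_ge0// ltW.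
(* Since max(y, 0) = (|y| + y) / 2 and the chain rule contributes a factor n, this is a primitive of
   the positive part for t >= 0. *)
pose G t := (2 * n%:R)^-1 * (F (n%:R * t + phi) + sin (n%:R * t + phi)).
have posE t : Num.max (A * cos (n%:R * t) + B * sin (n%:R * t)) 0 =
    (`|cos (n%:R * t + phi)| + cos (n%:R * t + phi)) / 2.
  have -> : A * cos (n%:R * t) + B * sin (n%:R * t) = cos (n%:R * t + phi).
    by rewrite cosD cphi sphi; ring.
  by case: ler0P => h; lra.
have dshift (t : R) : is_derive t 1 (fun t => n%:R * t + phi) n%:R.
  by apply: is_derive_eq; rewrite addr0 [LHS]mulr1.
have dcos (t : R) : is_derive t 1 (fun t => cos (n%:R * t + phi)) (- sin (n%:R * t + phi) * n%:R).
  exact: (is_derive1_comp (g := fun t => n%:R * t + phi)).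
have dG (t : R) : 0 <= t -> is_derive t 1 G (Num.max (A * cos (n%:R * t) + B * sin (n%:R * t)) 0).
  move=> t1.
  have ct : - pi - 1 < n%:R * t + phi.
    suff : 0 <= n%:R * t by lra.
    by rewrite mulr_ge0// ltW.
  have d1 := dF _ ct.
  have d2 : is_derive t 1 (fun t => F (n%:R * t + phi)) (`|cos (n%:R * t + phi)| * n%:R).
    exact: (is_derive1_comp (g := fun t => n%:R * t + phi)).
  have d3 : is_derive t 1 (fun t => sin (n%:R * t + phi)) (cos (n%:R * t + phi) * n%:R).
    exact: (is_derive1_comp (g := fun t => n%:R * t + phi)).
  rewrite posE /G; apply: is_derive_eq.

  rewrite -[LHS]/(_ * (_ + _)).
  by field; rewrite gt_eqF.
rewrite (@continuous_FTC2 _ _ G)//.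
- rewrite -EFinB /G mulr0 add0r; congr EFin.
  (* The phase advances by 2n half periods: [F] gains 4n, the sine returns to its value, and the
     factor 1 / (2n) leaves 2. *)
  have -> : n%:R * (2 * pi) + phi = phi + (2 * n)%:R * pi by rewrite natrM; ring.
  rewrite shift; last lra.
  have -> : sin (phi + (2 * n)%:R * pi) = sin phi.
    rewrite -(periodicn (@sinD2pi R) n phi); congr (sin (_ + _)).
    by rewrite -mulrnA mulr_natl.
  by rewrite natrM; field; rewrite gt_eqF.
- lra.
- apply: continuous_subspaceT => t.
  rewrite (_ : (fun _ => _) = fun t : R => (`|cos (n%:R * t + phi)| + cos (n%:R * t + phi)) / 2); last first.
    by apply/funext => x; rewrite posE.
  have ct : {for t, continuous (fun t : R => cos (n%:R * t + phi))}.
    exact: is_derive_continuous (dcos t).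
  apply: cvgM; last exact: cvg_cst.
  apply: (cvgD _ ct).
  exact: (cvg_norm ct).
- split.
  + by move=> t; rewrite in_itv/= => /andP[t0 _]; have [] := dG t (ltW t0).
  (* [dG] holds at the endpoint 0 itself, so two-sided continuity supplies the one-sided limit. *)
  + exact/cvg_at_right_filter/(is_derive_continuous _ _ _ (dG 0 _)).
  + apply/cvg_at_left_filter/(is_derive_continuous _ _ _ (dG _ _)).
    lra.
- move=> t; rewrite in_itv/= => /andP[t0 _].
  by have [_ <-] := dG t (ltW t0); rewrite derive1E.
Qed.

Lemma measurable_sinusoid {R : realType} (n : nat) (A B : R) :
  measurable_fun [set: R] (fun t => A * cos (n%:R * t) + B * sin (n%:R * t)).
Proof.
have mn : measurable_fun [set: R] (fun t => n%:R * t) by exact: measurable_funM.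
have mc : measurable_fun [set: R] cos by exact: (continuous_measurable_fun (@continuous_cos R)).
have ms : measurable_fun [set: R] sin by exact: (continuous_measurable_fun (@continuous_sin R)).
apply: measurable_funD; apply: measurable_funM => //.
  exact: measurableT_comp mc mn.
exact: measurableT_comp ms mn.
Qed.

(** The positive part vanishes off this set and equals [g] on it; the missing endpoint 2 pi is a
    null set. *)
Lemma integral_sinusoid_gt0 {R : realType} (n : nat) (A B : R) :
  (1 <= n)%N -> A ^+ 2 + B ^+ 2 = 1 ->
  let g t := A * cos (n%:R * t) + B * sin (n%:R * t) in
  (\int[lebesgue_measure]_(t in [set t | (0 <= t < 2 * pi)%R /\ (0 < g t)%R])
    (g t)%:E = 2%:E)%E.
Proof.
move=> n0 AB g.
have mg : measurable_fun setT g by exact: measurable_sinusoid.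
rewrite -(@integral_pos_part_sinusoid R n A B n0 AB) -integral_itv_bndo_bndc; last first.
  by apply: measurable_funTS; apply/measurable_EFinP; apply: measurable_maxr.
rewrite (_ : [set t | _] = `[0, 2 * pi[ `&` [set t | 0 < g t]); last first.
  by apply/seteqP; split => t/=; rewrite in_itv.
rewrite integral_mkcondr; apply: eq_integral => t _; rewrite patchE -/(g t).
by case: ifPn; rewrite ?inE/= ?notin_setE/= => h; [rewrite max_l ?ltW|rewrite max_r// leNgt; exact/negP].
Qed.

(** * The radial factor *)

Lemma measurable_radial_part {R : realType} (a : R) n m :
  measurable_fun [set: R] (radial_part a n m).
Proof.
apply: measurableT_comp; first exact: measurable_besselJ.
exact: measurable_funM.
Qed.

(** A bounded function on a set of finite measure. Finiteness lets the extended-real integrals be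
    identified with the real ones in [besselJ_integral]. *)
Lemma integrable_radial_part {R : realType} (a : R) n m (D : set R) :
  measurable D -> D `<=` [set r | 0 < r < a] ->
  lebesgue_measure.-integrable D (fun r : R => (radial_part a n m r * r)%:E).
Proof.
move=> mD Da; set c := besselJ_zero n m / a.
apply: measurable_bounded_integrable => //.
- rewrite (@le_lt_trans _ _ (lebesgue_measure `]0, a[))//.
    by apply: le_measure; rewrite ?inE// => r /Da; rewrite /= in_itv.
  by rewrite lebesgue_measure_itv/=; case: ifP; rewrite ?ltry.
- apply: measurable_funTS; apply: measurable_funM => //.
  exact: measurable_radial_part.
(* The growth bound for the Bessel function is monotone in r, so its value at r = a serves; the last
   [a] bounds the weight r. *)
exists ((`|c| * a / 2) ^+ n * expR ((c * a / 2) ^+ 2) * a); split; rewrite ?num_real//.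
move=> M /ltW KM r /Da /andP[r0 ra]; apply: le_trans KM.
have a0 := lt_trans r0 ra.
rewrite normrM [`|r|]gtr0_norm// ler_pM ?(ltW r0) ?(ltW ra)//.
apply: le_trans (normr_besselJ_le _ _) _; rewrite -/c.
rewrite ler_pM ?exprn_ge0 ?expR_ge0 ?divr_ge0//.
  rewrite lerXn2r ?nnegrE ?divr_ge0 ?mulr_ge0 ?(ltW a0)// ler_pM2r//.
  by rewrite normrM ler_wpM2l// gtr0_norm// ltW.
rewrite ler_expR 2!exprMn [leRHS]exprMn [(c * a) ^+ 2]exprMn ler_wpM2r ?sqr_ge0// ler_wpM2l ?sqr_ge0//.
by rewrite lerXn2r ?nnegrE ?ltW.
Qed.

(** Reconciles [polar_region], which allows r = 0, with the radial sets, which require r > 0. *)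
Lemma radial_part0 {R : realType} (a : R) n m :
  (1 <= n)%N -> radial_part a n m 0 = 0.
Proof.
move=> n0; apply/normr0_eq0/le_anti; rewrite normr_ge0 andbT.
apply: le_trans (normr_besselJ_le _ _) _.
by rewrite mulr0 normr0 mul0r expr0n gtn_eqF// mul0r.
Qed.

(** * Assembly over the disk *)

Lemma polar_disk {R : realType} (a r t : R) :
  0 < a -> 0 <= r -> disk a (polar (r, t)) = (r < a) :> Prop.
Proof.
move=> a0 r0; rewrite /disk /polar/=.
have -> : (r * cos t) ^+ 2 + (r * sin t) ^+ 2 = r ^+ 2.
  by rewrite !exprMn -mulrDr cos2Dsin2 mulr1.
by rewrite ltr_pXn2r// nnegrE ltW.
Qed.

Lemma polar_integral_gt0 {R : realType} (a : R) (n m : nat) (A B : R) :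
  0 < a -> (1 <= n)%N -> A ^+ 2 + B ^+ 2 = 1 ->
  let w := eigenfunction a n m A B in
  polar_integral (polar_region (disk a) `&` [set p | 0 < w p]) w
    = (besselJ_integral a n m)%:E.
Proof.
move=> a0 n0 AB w.
set f := radial_part a n m.
pose g t := A * cos (n%:R * t) + B * sin (n%:R * t).
have mf : measurable_fun setT f by exact: measurable_radial_part.
have mg : measurable_fun setT g by exact: measurable_sinusoid.
pose P := [set r | 0 < r < a /\ 0 < f r].
pose N := [set r | 0 < r < a /\ f r < 0].
pose TP := [set t | 0 <= t < 2 * pi /\ 0 < g t].
(* Written with [0 < - g t], this is [TP] for the coefficients [- A] and [- B], so the same angular
   integral applies. *)
pose TN := [set t | 0 <= t < 2 * pi /\ 0 < - g t].
have mpos (h : R -> R) : measurable_fun setT h -> measurable [set x | 0 < h x].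
  by move=> mh; rewrite -[X in measurable X]setTI; exact: measurable_fun_ltr.
have mP : measurable P.
  rewrite (_ : P = `]0, a[ `&` [set x | 0 < f x]).
    by apply: measurableI => //; exact: mpos.
  by apply/seteqP; split => r/=; rewrite in_itv.
have mN : measurable N.
  rewrite (_ : N = `]0, a[ `&` [set x | 0 < - f x]).
    by apply: measurableI => //; apply: mpos; exact: measurableT_comp.
  by apply/seteqP; split => r/=; rewrite in_itv/= oppr_gt0.
have mTP : measurable TP.
  rewrite (_ : TP = `[0, 2 * pi[ `&` [set x | 0 < g x]).
    by apply: measurableI => //; exact: mpos.
  by apply/seteqP; split => r/=; rewrite in_itv.
have mTN : measurable TN.
  rewrite (_ : TN = `[0, 2 * pi[ `&` [set x | 0 < - g x]).
    by apply: measurableI => //; apply: mpos; exact: measurableT_comp.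
  by apply/seteqP; split => r/=; rewrite in_itv.
have -> : polar_region (disk a) `&` [set p | 0 < w p] = P `*` TP `|` N `*` TN.
  apply/seteqP; split => -[r t] /=.
    move=> [[/= r0 t0]]; rewrite polar_disk// => ra.
    rewrite /w /eigenfunction/= -/f -/(g t) => fg.
    have rgt0 : 0 < r.
      rewrite lt_neqAle r0 andbT; apply/eqP => r00; move: fg.
      by rewrite -r00 /f radial_part0// mul0r ltxx.
    have [f0|f0|f0] := ltgtP (f r) 0.
    - right; split; split=> //=; first by rewrite rgt0.
      by rewrite oppr_gt0 -(nmulr_rgt0 _ f0).
    - left; split; split=> //=; first by rewrite rgt0.
      by rewrite -(pmulr_rgt0 _ f0).
    - by move: fg; rewrite f0 mul0r ltxx.
  rewrite /w /eigenfunction/= -/f -/(g t).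
  move=> [[[/andP[r0 ra] f0] [t0 g0]]|[[/andP[r0 ra] f0] [t0 g0]]]; split => /=.
  - by split=> //=; rewrite ?ltW// polar_disk// ltW.
  - exact: mulr_gt0.
  - by split=> //=; rewrite ?ltW// polar_disk// ltW.
  - by rewrite nmulr_rgt0// -oppr_gt0.
rewrite /polar_integral.
have mw : measurable_fun setT (fun p : R * R => (w p * p.1)%:E).
  apply/measurable_EFinP/measurable_funM => //.
  apply: measurable_funM.
    exact: measurableT_comp mf measurable_fst.
  exact: measurableT_comp mg measurable_snd.
rewrite ge0_integral_setU//; last 5 first.
- exact: measurableX.
- exact: measurableX.
- exact: measurable_funTS.
- move=> [r t]; rewrite /w /eigenfunction/= -/f -/(g t) lee_fin.
  move=> [[[/andP[r0 ra] f0] [t0 g0]]|[[/andP[r0 ra] f0] [t0 g0]]].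
    by rewrite !mulr_ge0// ltW.
  by rewrite mulr_ge0 ?(ltW r0)// nmulr_rge0// -oppr_ge0 ltW.
- apply/disj_set2P/seteqP; split => // -[r t] /= [[[_ f0] _] [[_ f1] _]].
  by move: (lt_trans f0 f1); rewrite ltxx.
have fin_f D : measurable D -> D `<=` [set r | 0 < r < a] ->
    (\int[lebesgue_measure]_(r in D) (f r * r)%:E)%E =
    (\int[lebesgue_measure]_(r in D) (f r * r))%:E.
  by move=> mD Da; rewrite fineK//; apply: integrable_fin_num => //; exact: integrable_radial_part.
have -> : (\int[(@lebesgue_measure R \x @lebesgue_measure R)]_(p in P `*` TP)
    (w p * p.1)%:E = (2 * \int[lebesgue_measure]_(r in P) (f r * r))%:E)%E.
  transitivity (\int[(@lebesgue_measure R \x @lebesgue_measure R)]_(p in P `*` TP)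
      ((fun r => f r * r) p.1 * g p.2)%:E)%E.
    by apply: eq_integral => p _; rewrite /w /eigenfunction mulrAC.
  apply: etrans (ge0_integral_setX (@lebesgue_measure R) (@lebesgue_measure R) _ _
    (fun r => f r * r) g mP mTP _ _ _ _) _.
  - by apply: measurable_funTS; exact: measurable_funM.
  - exact: measurable_funTS.
  - by move=> r [/andP[r0 _] f0]; rewrite mulr_ge0// ltW.
  - by move=> t [_ /ltW].
  - rewrite integral_sinusoid_gt0// fin_f// => [|r []//].
    by rewrite -EFinM mulrC.
have -> : (\int[(@lebesgue_measure R \x @lebesgue_measure R)]_(p in N `*` TN)
    (w p * p.1)%:E = (- (2 * \int[lebesgue_measure]_(r in N) (f r * r)))%:E)%E.
  (* On [N] and [TN] both factors are negative. Negating both keeps the product and meets the sign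
     conditions of Tonelli; the radial sign then yields the minus in [besselJ_integral]. *)
  have Ng t : - g t = (- A) * cos (n%:R * t) + (- B) * sin (n%:R * t).
    by rewrite opprD !mulNr.
  transitivity (\int[(@lebesgue_measure R \x @lebesgue_measure R)]_(p in N `*` TN)
      ((fun r => - (f r * r)) p.1 * (fun t => - g t) p.2)%:E)%E.
    by apply: eq_integral => p _; rewrite /w /eigenfunction mulrAC -mulrNN.
  apply: etrans (ge0_integral_setX (@lebesgue_measure R) (@lebesgue_measure R) _ _
    (fun r => - (f r * r)) (fun t => - g t) mN mTN _ _ _ _) _.
  - by apply: measurable_funTS; apply: measurableT_comp => //; exact: measurable_funM.
  - by apply: measurable_funTS; exact: measurableT_comp.
  - by move=> r [/andP[r0 _] f0]; rewrite oppr_ge0 nmulr_rle0// ltW.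
  - by move=> t [_ /ltW].
  - have -> : (\int[lebesgue_measure]_(t in TN) (- g t)%:E = 2%:E)%E.
      rewrite /TN (_ : g = fun t => - (- A * cos (n%:R * t) + - B * sin (n%:R * t))); last first.
        by apply/funext => t; rewrite -Ng opprK.
      under eq_integral do rewrite opprK.
      under eq_set do rewrite opprK.
      by rewrite integral_sinusoid_gt0// !sqrrN.
    under eq_integral do rewrite EFinN.
    have iN : lebesgue_measure.-integrable N (fun r : R => (f r * r)%:E).
      by apply: integrable_radial_part => // r [].
    rewrite (integralN (integrable_add_def (mu := @lebesgue_measure R) _ iN))//.
    rewrite fin_f// => [|r []//].
    by rewrite -EFinN -EFinM mulNr mulrC.
by rewrite -EFinD.
Qed.

Theorem proposition3 (R : realType) (a : R) (n m : nat) (A B : R)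
  (a_gt0 : 0 < a)
  (n_gt0 : (1 <= n)%N)
  (m_gt0 : (1 <= m)%N)
  (above_principal : principal_eigenvalue a < dirichlet_eigenvalue a n m)
  (normalized : A ^+ 2 + B ^+ 2 = 1) :
  let w := eigenfunction a n m A B in
  polar_integral (polar_region (disk a) `&` [set p | 0 < w p]) w
    = (besselJ_integral a n m)%:E
  /\
  polar_integral (polar_region (disk a) `&` [set p | w p < 0]) w
    = (- besselJ_integral a n m)%:E.
Proof.
move=> w; split; first exact: polar_integral_gt0.
pose w' := eigenfunction a n m (- A) (- B).
have wE p : w p = - w' p.
  by rewrite /w /w' /eigenfunction !mulNr -opprD mulrN opprK.
have := @polar_integral_gt0 R a n m (- A) (- B) a_gt0 n_gt0.
rewrite !sqrrN => /(_ normalized) /=; rewrite -/w' => H.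
rewrite EFinN -H /polar_integral.
rewrite (_ : [set p | w p < 0] = [set p | 0 < w' p]); last first.
  by apply/seteqP; split => p/=; rewrite wE oppr_lt0.
under eq_integral do rewrite wE mulNr EFinN.
(* The sign leaves the integral because [w' p * p.1] is nonnegative on this set, with [0 <= p.1]
   coming from [polar_region]. *)
rewrite integral_ge0N// => p [[p0 _ _] /= w0].
by rewrite lee_fin mulr_ge0// ltW.
Qed.
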